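(* Let $A=(a_{ij})\in\mathbb{R}^{n\times n}$ be symmetric positive definite and $\bm{b}\in\mathbb{R}^n$. Write $A=D+L+U$ with $D=\mathrm{diag}(a_{11},\dots,a_{nn})$, $L$ strictly lower triangular and $U$ strictly upper triangular. Let $h>0$ be the stepsize of the Itoh--Abe discrete gradient scheme with $P=D^{-1}$ for the energy function $f(\bm{x})=\frac12\bm{x}^\top A\bm{x}-\bm{x}^\top\bm{b}$, and let $\omega\in(0,2)$ be the relaxation parameter of the SOR method for $A\bm{x}=\bm{b}$. If $$h=\frac{2\omega}{2-\omega},$$ then the Itoh--Abe discrete gradient scheme and the SOR method are equivalent in the sense that $G_{\mathrm{DG}}=G_{\mathrm{SOR}}$ and $\bm{c}_{\mathrm{DG}}=\bm{c}_{\mathrm{SOR}}$, where $\bm{x}^{(k+1)}=G_{\mathrm{DG}}\bm{x}^{(k)}+\bm{c}_{\mathrm{DG}}$ and $\bm{x}^{(k+1)}=G_{\mathrm{SOR}}\bm{x}^{(k)}+\bm{c}_{\mathrm{SOR}}$ are the matrix forms of the two methods.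
   Context: For $f:\mathbb{R}^n\to\mathbb{R}$, the Itoh--Abe discrete gradient $\nabla_{\mathrm d} f(\bm{x},\bm{y})$ has $i$th component $$\frac{f(x_1,\dots,x_i,y_{i+1},\dots,y_n)-f(x_1,\dots,x_{i-1},y_i,\dots,y_n)}{x_i-y_i},$$ which for $f(\bm{x})=\frac12\bm{x}^\top A\bm{x}-\bm{x}^\top\bm{b}$ equals $\sum_{j<i}a_{ij}x_j+a_{ii}\frac{x_i+y_i}{2}+\sum_{j>i}a_{ij}y_j-b_i$ (this formula is used also when $x_i=y_i$). The discrete gradient scheme with stepsize $h>0$ and symmetric positive definite matrix $P$ is $\frac{\bm{x}^{(k+1)}-\bm{x}^{(k)}}{h}=-P\,\nabla_{\mathrm d} f(\bm{x}^{(k+1)},\bm{x}^{(k)})$, $k=0,1,2,\dots$. For $P=D^{-1}$ (note $a_{ii}>0$) the Itoh--Abe scheme is, for $i=1,\dots,n$, $$x_i^{(k+1)}=\frac{1}{1+\frac h2}\Big[-h a_{ii}^{-1}\sum_{j<i}a_{ij}x_j^{(k+1)}+\Big(1-\frac h2\Big)x_i^{(k)}-h a_{ii}^{-1}\sum_{j>i}a_{ij}x_j^{(k)}+h a_{ii}^{-1}b_i\Big],$$ and its matrix form $\bm{x}^{(k+1)}=G_{\mathrm{DG}}\bm{x}^{(k)}+\bm{c}_{\mathrm{DG}}$ has $$G_{\mathrm{DG}}=\Big[\Big(1+\frac h2\Big)D+hL\Big]^{-1}\Big[\Big(1-\frac h2\Big)D-hU\Big],\qquad \bm{c}_{\mathrm{DG}}=h\Big[\Big(1+\frac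 h2\Big)D+hL\Big]^{-1}\bm{b}.$$ The SOR method with relaxation parameter $\omega$ is $\bm{x}^{(k+1)}=G_{\mathrm{SOR}}\bm{x}^{(k)}+\bm{c}_{\mathrm{SOR}}$ with $$G_{\mathrm{SOR}}=(D+\omega L)^{-1}[(1-\omega)D-\omega U],\qquad \bm{c}_{\mathrm{SOR}}=\omega(D+\omega L)^{-1}\bm{b}.$$ *)

(* Defs.v *)
From mathcomp Require Import all_boot all_order all_algebra.
From mathcomp Require Import reals.
Set Implicit Arguments.
Unset Strict Implicit.
Unset Printing Implicit Defensive.
Import Order.TTheory GRing.Theory Num.Theory.
Local Open Scope ring_scope.

Definition positive_definite (R : realType) (n : nat) (A : 'M[R]_n) : Prop :=
  forall x : 'cV[R]_n, x != 0 -> 0 < (x^T *m A *m x) 0 0.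

Definition spd (R : realType) (n : nat) (A : 'M[R]_n) : Prop :=
  A \is symmetricmx /\ positive_definite A.

Definition strictly_lower (R : realType) (n : nat) (L : 'M[R]_n) : Prop :=
  forall i j : 'I_n, (i <= j)%N -> L i j = 0.

Definition strictly_upper (R : realType) (n : nat) (U : 'M[R]_n) : Prop :=
  forall i j : 'I_n, (j <= i)%N -> U i j = 0.

Definition energy (R : realType) (n : nat) (A : 'M[R]_n) (b x : 'cV[R]_n) : R :=
  2^-1 * (x^T *m A *m x) 0 0 - (x^T *m b) 0 0.

(* (x_1, ..., x_k, y_(k+1), ..., y_n) *)
Definition splice (R : realType) (n k : nat) (x y : 'cV[R]_n) : 'cV[R]_n :=
  \col_j (if (j < k)%N then x j 0 else y j 0).

(* Indices are 0-based, so the numerator compares the arguments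
   (x_0, ..., x_i, y_(i+1), ...) and (x_0, ..., x_(i-1), y_i, ...).
   Meaningful only for x_i != y_i. *)
Definition itoh_abe_quotient (R : realType) (n : nat) (f : 'cV[R]_n -> R)
    (x y : 'cV[R]_n) (i : 'I_n) : R :=
  (f (splice i.+1 x y) - f (splice i x y)) / (x i 0 - y i 0).

Definition quadratic_itoh_abe (R : realType) (n : nat) (A : 'M[R]_n)
    (b x y : 'cV[R]_n) (i : 'I_n) : R :=
  \sum_(j < n | (j < i)%N) A i j * x j 0
  + A i i * ((x i 0 + y i 0) / 2)
  + \sum_(j < n | (i < j)%N) A i j * y j 0
  - b i 0.

(* The Itoh--Abe discrete gradient of [energy A b]: the difference quotient,
   extended to x_i = y_i by the closed formula for quadratic functions. *)
Definition itoh_abe_energy (R : realType) (n : nat) (A : 'M[R]_n)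
    (b x y : 'cV[R]_n) : 'cV[R]_n :=
  \col_i (if x i 0 == y i 0 then quadratic_itoh_abe A b x y i
          else itoh_abe_quotient (energy A b) x y i).

(* [dg x y] is a discrete gradient; the scheme is implicit since x_(k+1) also
   occurs on the right-hand side. *)
Definition discrete_gradient_scheme (R : realType) (n : nat)
    (dg : 'cV[R]_n -> 'cV[R]_n -> 'cV[R]_n) (P : 'M[R]_n) (h : R)
    (x : nat -> 'cV[R]_n) : Prop :=
  forall k : nat, h^-1 *: (x k.+1 - x k) = - (P *m dg (x k.+1) (x k)).

Definition linear_iteration (R : realType) (n : nat) (G : 'M[R]_n)
    (c : 'cV[R]_n) (x : nat -> 'cV[R]_n) : Prop :=
  forall k : nat, x k.+1 = G *m x k + c.

(* The inverses in the four definitions below are genuine when D has positive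
   diagonal, L is strictly lower triangular and h, omega are positive. *)
Definition G_DG (R : realType) (n : nat) (D L U : 'M[R]_n) (h : R) : 'M[R]_n :=
  invmx ((1 + h / 2) *: D + h *: L) *m ((1 - h / 2) *: D - h *: U).

Definition c_DG (R : realType) (n : nat) (D L : 'M[R]_n) (b : 'cV[R]_n) (h : R)
    : 'cV[R]_n :=
  h *: (invmx ((1 + h / 2) *: D + h *: L) *m b).

Definition G_SOR (R : realType) (n : nat) (D L U : 'M[R]_n) (omega : R)
    : 'M[R]_n :=
  invmx (D + omega *: L) *m ((1 - omega) *: D - omega *: U).

Definition c_SOR (R : realType) (n : nat) (D L : 'M[R]_n) (b : 'cV[R]_n)
    (omega : R) : 'cV[R]_n :=
  omega *: (invmx (D + omega *: L) *m b).

(* Main.v *)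
(* For a quadratic energy the difference quotient in the i-th coordinate equals
   the closed formula, so the scheme with P = D^-1, multiplied by h D, reads
   ((1 + h/2) D + h L) x' = ((1 - h/2) D - h U) x + h b, whose left matrix is
   triangular with positive diagonal.  When h = 2 omega / (2 - omega), the
   scalar s = 2 / (2 - omega) satisfies 1 + h/2 = s, 1 - h/2 = s (1 - omega) and
   h = s omega, so both sides are s times those of the SOR iteration. *)
Require Import Defs.
From mathcomp Require Import all_boot all_order all_algebra.
From mathcomp Require Import reals.
From mathcomp Require Import ring.
Set Implicit Arguments.
Unset Strict Implicit.
Unset Printing Implicit Defensive.
Import Order.TTheory GRing.Theory Num.Theory.
Local Open Scope ring_scope.

(** The quadratic form at the i-th basis vector is [A i i]. *)
Lemma spd_diag_gt0 (R : realType) (n : nat) (A : 'M[R]_n) (i : 'I_n) :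
  spd A -> 0 < A i i.
Proof.
move=> [_ Apos]; pose e : 'cV[R]_n := delta_mx i 0; have := Apos e.
have -> : (e^T *m A *m e) 0 0 = A i i.
  by rewrite trmx_delta -rowE -colE !mxE.
apply; apply/eqP => /matrixP/(_ i 0); rewrite !mxE !eqxx /=.
by move/eqP; rewrite oner_eq0.
Qed.

(** Exact second-order expansion along a coordinate axis. The factor [t] is pulled out so that it
    cancels in the difference quotient. *)
Lemma energy_shift (R : realType) (n : nat) (A : 'M[R]_n) (b z : 'cV[R]_n)
    (i : 'I_n) (t : R) :
  A \is symmetricmx ->
  energy A b (z + t *: delta_mx i 0) - energy A b z =
  t * ((A *m z) i 0 + A i i * (t / 2) - b i 0).
Proof.
move=> Asym.
have At : A^T = A.
  (* [symmetricmx] is the Hermitian predicate with sign (-1)^0 and the identity as conjugation. *)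
  by move/is_hermitianmxP: Asym => {2}->; rewrite expr0 scale1r map_mx_id.
pose e : 'cV[R]_n := delta_mx i 0.
have eE (v : 'cV[R]_n) : (e^T *m v) 0 0 = v i 0.
  by rewrite trmx_delta -rowE mxE.
have eAz : (e^T *m A *m z) 0 0 = (A *m z) i 0 by rewrite -mulmxA eE.
have zAe : (z^T *m A *m e) 0 0 = (A *m z) i 0.
  (* A 1 x 1 matrix equals its transpose, so symmetry of [A] makes the two cross terms agree. *)
  have trE (M : 'M[R]_1) : M 0 0 = M^T 0 0 by rewrite mxE.
  by rewrite trE !trmx_mul trmxK At mulmxA.
have eAe : (e^T *m A *m e) 0 0 = A i i.
  by rewrite -mulmxA eE -colE mxE.
have eT : (z + t *: e)^T = z^T + t *: e^T by rewrite linearD linearZ.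
rewrite /energy -/e eT !mulmxDl !mulmxDr -!scalemxAl -!scalemxAr.
have addE (M N : 'M[R]_1) : (M + N) 0 0 = M 0 0 + N 0 0 by rewrite mxE.
have sclE (a : R) (M : 'M[R]_1) : (a *: M) 0 0 = a * M 0 0 by rewrite mxE.
rewrite !(addE, sclE) eAz zAe eAe eE.
by field.
Qed.

(** Puts the numerator of the difference quotient in the form required by [energy_shift]. *)
Lemma spliceS (R : realType) (n : nat) (x y : 'cV[R]_n) (i : 'I_n) :
  splice i.+1 x y = splice i x y + (x i 0 - y i 0) *: delta_mx i 0.
Proof.
apply/matrixP => j k; rewrite !mxE !ord1 eqxx andbT ltnS.
case: (ltngtP j i) => [ji|ij|/val_inj ->].
- by rewrite -val_eqE /= (ltn_eqF ji) mulr0 addr0.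
- by rewrite -val_eqE /= (gtn_eqF ij) mulr0 addr0.
- by rewrite eqxx mulr1 addrC subrK.
Qed.

Lemma sum_ord_ltn_gtn (R : realType) (n : nat) (i : 'I_n) (F : 'I_n -> R) :
  \sum_j F j =
  \sum_(j < n | (j < i)%N) F j + F i + \sum_(j < n | (i < j)%N) F j.
Proof.
rewrite (bigID (fun j : 'I_n => (j < i)%N)) /= -addrA; congr (_ + _).
rewrite (bigD1 i) ?ltnn //=; congr (_ + _); apply: eq_bigl => j.
by rewrite -leqNgt -val_eqE /= ltn_neqAle eq_sym andbC.
Qed.

Lemma itoh_abe_energyE (R : realType) (n : nat) (A : 'M[R]_n)
    (b x y : 'cV[R]_n) (i : 'I_n) :
  A \is symmetricmx ->
  itoh_abe_energy A b x y i 0 = quadratic_itoh_abe A b x y i.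
Proof.
move=> Asym; rewrite mxE; case: eqVneq => // xy_neq.
have t_neq0 : x i 0 - y i 0 != 0 by rewrite subr_eq0.
rewrite /itoh_abe_quotient spliceS energy_shift // mulrC mulKf //.
(* The smaller splice still carries y_i at index i; y_i + (x_i - y_i)/2 is then the midpoint in the
   closed formula. *)
rewrite mxE (sum_ord_ltn_gtn i) !mxE ltnn /quadratic_itoh_abe.
rewrite [\sum_(j < n | (j < i)%N) _](eq_bigr (fun j => A i j * x j 0)); last first.
  by move=> j ji; rewrite mxE ji.
rewrite [\sum_(j < n | (i < j)%N) _](eq_bigr (fun j => A i j * y j 0)); last first.
  by move=> j ij; rewrite mxE ltnNge (ltnW ij).
by field.
Qed.

Section Splitting.

Variables (R : realType) (n : nat) (A D L U : 'M[R]_n).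
Hypotheses (A_split : A = D + L + U) (D_diag : D = diag_mx (\row_i A i i)).
Hypotheses (L_lower : strictly_lower L) (U_upper : strictly_upper U).

Lemma itoh_abe_energy_splitE (b x y : 'cV[R]_n) :
  A \is symmetricmx ->
  itoh_abe_energy A b x y = L *m x + 2^-1 *: (D *m (x + y)) + U *m y - b.
Proof.
move=> Asym; apply/matrixP => i k; rewrite ord1 itoh_abe_energyE //.
have DE : (D *m (x + y)) i 0 = A i i * (x i 0 + y i 0).
  by rewrite D_diag mul_diag_mx !mxE.
(* Off the diagonal [D] vanishes, so each entry of [A] comes from [L] below and from [U] above. *)
have offdiag j : j != i -> A i j = L i j + U i j.
  move=> ji; rewrite [in LHS]A_split !mxE D_diag !mxE eq_sym (negbTE ji) mulr0n.
  by rewrite add0r.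
have LE : (L *m x) i 0 = \sum_(j < n | (j < i)%N) A i j * x j 0.
  rewrite mxE [RHS]big_mkcond; apply: eq_bigr => j _.
  case: ltnP => [ji|/L_lower ->]; last by rewrite mul0r.
  by rewrite offdiag -?val_eqE /= ?(ltn_eqF ji) // (U_upper (ltnW ji)) addr0.
have UE : (U *m y) i 0 = \sum_(j < n | (i < j)%N) A i j * y j 0.
  rewrite mxE [RHS]big_mkcond; apply: eq_bigr => j _.
  case: ltnP => [ij|/U_upper ->]; last by rewrite mul0r.
  by rewrite offdiag -?val_eqE /= ?(gtn_eqF ij) // (L_lower (ltnW ij)) add0r.
have entryE (u v w z : 'cV[R]_n) : (u + 2^-1 *: v + w - z) i 0 =
    u i 0 + 2^-1 * v i 0 + w i 0 - z i 0 by rewrite !mxE.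
rewrite entryE LE UE DE /quadratic_itoh_abe.
by field.
Qed.

(** The matrix is lower triangular with diagonal entries [a * A i i], all nonzero. The choice of [a]
    and [c] covers [D] itself and the left matrices of both methods. *)
Lemma diag_lower_unitmx (a c : R) :
  spd A -> a != 0 -> a *: D + c *: L \in unitmx.
Proof.
move=> A_spd a0; rewrite unitmxE det_trig.
  rewrite unitfE prodf_seq_neq0; apply/allP => i _ /=.
  rewrite D_diag !mxE L_lower // mulr0 addr0 eqxx mulr1n mulf_neq0 //.
  by rewrite gt_eqF // spd_diag_gt0.
apply/is_trig_mxP => i j ij.
by rewrite D_diag !mxE -val_eqE /= (ltn_eqF ij) L_lower ?(ltnW ij) // !mulr0 addr0.
Qed.

Lemma discrete_gradient_scheme_linear (b : 'cV[R]_n) (h : R)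
    (x : nat -> 'cV[R]_n) :
  spd A -> 0 < h ->
  discrete_gradient_scheme (itoh_abe_energy A b) (invmx D) h x <->
  linear_iteration (G_DG D L U h) (c_DG D L b h) x.
Proof.
move=> A_spd h_gt0.
have h0 : h != 0 by rewrite gt_eqF.
have Dunit : D \in unitmx.
  by have := diag_lower_unitmx 0 A_spd (oner_neq0 R); rewrite scale1r scale0r addr0.
have Munit : (1 + h / 2) *: D + h *: L \in unitmx.
  by apply: diag_lower_unitmx => //; rewrite gt_eqF // addr_gt0 // divr_gt0.
(* Both conditions relate only consecutive iterates, so a single step suffices. *)
suff step (u v : 'cV[R]_n) :
    h^-1 *: (u - v) = - (invmx D *m itoh_abe_energy A b u v) <->
    u = G_DG D L U h *m v + c_DG D L b h.
  by split=> Hx k; apply/step/Hx.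
rewrite itoh_abe_energy_splitE ?(proj1 A_spd) //.
set g := _ - b.
pose M := (1 + h / 2) *: D + h *: L.
pose N := (1 - h / 2) *: D - h *: U.
(* The residual of the scheme, multiplied by h D, is the residual of the linear system M u = N v + h
   b. *)
have residual : D *m (u - v) + h *: g = M *m u - (N *m v + h *: b).
  rewrite /g /M /N !(mulmxDl, mulmxDr, mulmxN, mulNmx) -!scalemxAl.
  by apply/matrixP => i j; rewrite !mxE; field.
have -> : G_DG D L U h *m v + c_DG D L b h = invmx M *m (N *m v + h *: b).
  by rewrite [RHS]mulmxDr -scalemxAr mulmxA.
(* Multiplication by h D loses nothing, since h is nonzero and [D] is invertible. *)
have -> : h^-1 *: (u - v) = - (invmx D *m g) <-> D *m (u - v) + h *: g = 0.
  split=> [E|/eqP].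
    rewrite -[u - v](scalerKV h0) E -scalemxAr mulmxN mulKVmx //.
    by rewrite scalerN addNr.
  rewrite addr_eq0 => /eqP E.
  rewrite -[u - v](mulKmx Dunit) E mulmxN -scalemxAr scalerN scalerK //.
rewrite residual; split=> [/subr0_eq <-|->]; first by rewrite mulKmx.
by rewrite mulKVmx ?subrr.
Qed.

End Splitting.

Theorem theorem1 (R : realType) (n : nat) (A D L U : 'M[R]_n) (b : 'cV[R]_n)
    (h omega : R)
    (A_spd : spd A)
    (A_split : A = D + L + U)
    (D_diag : D = diag_mx (\row_i A i i))
    (L_lower : strictly_lower L)
    (U_upper : strictly_upper U)
    (h_gt0 : 0 < h)
    (omega_gt0 : 0 < omega)
    (omega_lt2 : omega < 2)
    (h_omega : h = 2 * omega / (2 - omega)) :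
  (forall x : nat -> 'cV[R]_n,
     discrete_gradient_scheme (itoh_abe_energy A b) (invmx D) h x <->
     linear_iteration (G_DG D L U h) (c_DG D L b h) x)
  /\ G_DG D L U h = G_SOR D L U omega
  /\ c_DG D L b h = c_SOR D L b omega.
Proof.
split; first by move=> x; exact: discrete_gradient_scheme_linear.
have w0 : 2 - omega != 0 by rewrite gt_eqF // subr_gt0.
pose s : R := 2 / (2 - omega).
have s0 : s != 0 by rewrite mulf_neq0 ?invr_eq0 // pnatr_eq0.
have hE : h = s * omega by rewrite h_omega /s; field.
have shiftP : 1 + h / 2 = s by rewrite h_omega /s; field.
have shiftN : 1 - h / 2 = s * (1 - omega) by rewrite h_omega /s; field.
have Munit : D + omega *: L \in unitmx.
  rewrite -[D]scale1r; apply: (diag_lower_unitmx D_diag) => //.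
  exact: oner_neq0.
(* The left matrix of the scheme is s times that of SOR, which gives the factor s^-1. *)
have invE : invmx ((1 + h / 2) *: D + h *: L) =
    s^-1 *: invmx (D + omega *: L).
  by rewrite shiftP hE -scalerA -scalerDr invmxZ // unitmxZ ?unitfE.
(* Only s != 0 matters from here: s^-1 from the inverse cancels s from the right-hand side. *)
rewrite /G_DG /c_DG /G_SOR /c_SOR invE shiftN hE; move: (s) s0 => r r0; split.
  by rewrite -!scalerA -scalerBr -scalemxAl -scalemxAr scalerA mulVf // scale1r.
by rewrite -scalemxAl scalerA mulrAC mulfV // mul1r.
Qed.
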